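(* Let $a,b>0$, let $X^*=(x^*,y^* )$ be an equilibrium of the H\'enon system $x_{n+1}=y_n+1-ax_n^2$, $y_{n+1}=bx_n$, and let $0<R<|x^*|$. Then there exist constants $\alpha_*=\alpha_*(R)\in[0,1)$ and $\beta_*=\beta_*(R)\in[0,1)$ such that, for any sequences $\alpha_n\in(\alpha_*,1)$, $\beta_n\in(\beta_*,1)$, $n\in\mathbb N_0$, and any initial value $(x_0,y_0)\in B_R(X^* )$, the solution of $$x_{n+1}=\alpha_n x^*+(1-\alpha_n)(y_n+1-ax_n^2),\qquad y_{n+1}=\beta_n y^*+(1-\beta_n)bx_n,\qquad n\in\mathbb N_0,$$ converges to $(x^*,y^* )$.
   Context: $\mathbb N_0=\{0\}\cup\mathbb N$; $\|\cdot\|$ is a fixed (arbitrary) norm on $\mathbb R^2$ and $B_R(X^* )=\{X\in\mathbb R^2:\|X-X^*\|<R\}$. The equilibria of the H\'enon system are $(x^*,y^* )=\left(\frac{1}{2a}\left[b-1\pm\sqrt{4a+(b-1)^2}\right],\,bx^*\right)$. *)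

(* Defs.v *)
From mathcomp Require Import all_boot all_order all_algebra.
From mathcomp Require Import all_classical all_reals all_analysis.

Set Implicit Arguments.
Unset Strict Implicit.
Unset Printing Implicit Defensive.

Import Order.TTheory GRing.Theory Num.Theory.
Import numFieldNormedType.Exports.

Local Open Scope classical_set_scope.
Local Open Scope ring_scope.

(* An arbitrary norm on the plane [R * R], kept separate from the norm that
   the library attaches canonically to this type (the maximum norm).
   Nonnegativity and [N 0 = 0] follow from the three axioms. *)
Record is_norm (R : realType) (N : R * R -> R) : Prop := IsNorm {
  is_norm_triangle : forall X Y : R * R, N (X + Y) <= N X + N Y;
  is_norm_scale : forall (c : R) (X : R * R), N (c *: X) = `|c| * N X;
  is_norm_eq0 : forall X : R * R, N X = 0 -> X = 0
}.

Definition norm_ball (R : realType) (N : R * R -> R) (C : R * R) (r : R) :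
    set (R * R) :=
  [set X | N (X - C) < r].

Definition henon (R : realType) (a b : R) (X : R * R) : R * R :=
  (X.2 + 1 - a * X.1 ^+ 2, b * X.1).

Definition henon_equilibrium (R : realType) (a b : R) (X : R * R) : Prop :=
  henon a b X = X.

(* Main.v *)
Require Import Defs.
From mathcomp Require Import all_boot all_order all_algebra.
From mathcomp Require Import all_classical all_reals all_analysis.
From mathcomp Require Import ring lra.

Set Implicit Arguments.
Unset Strict Implicit.
Unset Printing Implicit Defensive.

Import Order.TTheory GRing.Theory Num.Theory.
Import numFieldNormedType.Exports.

Local Open Scope classical_set_scope.
Local Open Scope ring_scope.

(** Write [U = X - X*] for the deviation from the equilibrium. Since [X*] is a
    fixed point of the Henon map, the controlled recursion reads, in the
    deviations [(u, v)],
      [u' = (1 - alpha) (v - a u (u + 2 x* ))],   [v' = (1 - beta) b u].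
    Both right-hand sides vanish at the origin, and as long as
    [max(|u|, |v|) <= K] the factors behind [1 - alpha] and [1 - beta] are at
    most [(1 + a (K + 2 |x*|)) max(|u|, |v|)] and [b max(|u|, |v|)]. Taking
    [alpha] and [beta] close enough to 1 therefore makes one step halve the
    maximum norm of the deviation ([henon_pbc_halves]); in particular the bound
    [K] persists, and the deviation decays geometrically whatever the controls
    are ([cvg_halving]).

    The initial value is only known to lie in a ball of an arbitrary norm [N],
    so a bound [K] for the maximum norm on that ball is required. It comes from
    the equivalence of norms on the plane ([is_norm_dominates]): each coordinate
    of [X] is at most a constant times [N X], because the distance, measured by
    [N], from one basis vector to the line spanned by the other one is attained
    and hence positive ([is_norm_dist_line]). *)

Section NormOnThePlane.
Variables (R : realType) (N : R * R -> R).
Hypothesis hN : is_norm N.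

Lemma is_norm0 : N 0 = 0.
Proof. by rewrite -(scale0r (0 : R * R)) (is_norm_scale hN) normr0 mul0r. Qed.

Lemma is_normN X : N (- X) = N X.
Proof. by rewrite -scaleN1r (is_norm_scale hN) normrN1 mul1r. Qed.

Lemma is_norm_ge0 X : 0 <= N X.
Proof.
have := is_norm_triangle hN X (- X).
by rewrite subrr is_norm0 is_normN; lra.
Qed.

Lemma is_norm_gt0 X : X != 0 -> 0 < N X.
Proof.
move=> X0; rewrite lt_def is_norm_ge0 andbT.
by apply: contra_neq X0; exact: is_norm_eq0.
Qed.

Lemma is_norm_dist X Y : `|N X - N Y| <= N (X - Y).
Proof.
have h1 := is_norm_triangle hN (X - Y) Y.
have h2 := is_norm_triangle hN (Y - X) X.
rewrite subrK in h1; rewrite subrK -opprB is_normN in h2.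
by rewrite ler_norml; apply/andP; split; lra.
Qed.

Lemma is_norm_line_continuous (e f : R * R) :
  continuous (fun t : R => N (e + t *: f)).
Proof.
move=> t; apply/cvgrPdist_le => eps eps0.
have c0 : 0 < N f + 1 by have := is_norm_ge0 f; lra.
near=> s.
apply: (le_trans (is_norm_dist _ _)).
rewrite opprD addrACA subrr add0r -scalerBl (is_norm_scale hN).
apply: (@le_trans _ _ (`|t - s| * (N f + 1))).
  by rewrite ler_wpM2l // lerDl.
rewrite -ler_pdivlMr //.
by near: s; apply: cvgr_dist_le; rewrite ?divr_gt0//; exact: cvg_id.
Unshelve. all: by end_near. Qed.

(** The continuous function [t |-> N (e + t f)] is at least [N e] outside a
    bounded interval, so its infimum is attained on that interval; the minimum
    is positive because the line avoids the origin. Completeness of [R] is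
    essential: over the rationals [|x + sqrt 2 * y|] is a norm for which the
    infimum can be 0. *)
Lemma is_norm_dist_line (e f : R * R) :
  f != 0 -> (forall t : R, e + t *: f != 0) ->
  exists2 m : R, 0 < m & forall t : R, m <= N (e + t *: f).
Proof.
move=> f0 ef0.
have Nf := is_norm_gt0 f0; have Ne := is_norm_ge0 e.
(* if [|t| > T], then [N (e + t f) >= |t| N f - N e >= N e] *)
pose T := 2 * N e / N f.
have T0 : 0 <= T by rewrite divr_ge0// ?mulr_ge0// ltW.
have TT : - T <= T by lra.
have [c _ cmin] := EVT_min TT
  (continuous_subspaceT (@is_norm_line_continuous e f)).
exists (N (e + c *: f)) => [|t]; first exact: is_norm_gt0.
have [tT|tT] := leP `|t| T.
  by apply: cmin; rewrite in_itv /= -ler_norml.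
apply: (@le_trans _ _ (N e)).
  have := cmin 0; rewrite scale0r addr0; apply.
  by rewrite in_itv /=; apply/andP; split; lra.
have h : `|t| * N f - N e <= N (e + t *: f).
  have := is_norm_triangle hN (e + t *: f) (- e).
  by rewrite addrAC subrr add0r is_normN (is_norm_scale hN); lra.
have : 2 * N e <= `|t| * N f by rewrite -ler_pdivrMr// ltW.
by lra.
Qed.

(** Factoring [x] out of [x e + y f = x (e + (y / x) f)] reduces the estimate
    to the distance from [e] to the line spanned by [f]. *)
Lemma is_norm_coord_le (e f : R * R) :
  f != 0 -> (forall t : R, e + t *: f != 0) ->
  exists2 M : R, 0 < M & forall x y : R, `|x| <= M * N (x *: e + y *: f).
Proof.
move=> f0 ef0; have [m m0 mP] := is_norm_dist_line f0 ef0.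
exists m^-1 => [|x y]; first by rewrite invr_gt0.
have [->|x0] := eqVneq x 0.
  by rewrite normr0 mulr_ge0 ?is_norm_ge0// invr_ge0 ltW.
have -> : x *: e + y *: f = x *: (e + (y / x) *: f).
  by rewrite scalerDr scalerA mulrCA divff// mulr1.
by rewrite (is_norm_scale hN) mulrC ler_pdivlMr// ler_wpM2l.
Qed.

Lemma is_norm_dominates :
  exists2 M : R, 0 < M & forall X : R * R, `|X| <= M * N X.
Proof.
have e1E (x y : R) : x *: ((1, 0) : R * R) + y *: ((0, 1) : R * R) = (x, y).
  by congr pair; rewrite /= /GRing.scale /=; ring.
have e10 (t : R) : ((1, 0) : R * R) + t *: ((0, 1) : R * R) != 0.
  by rewrite -[X in X + _]scale1r e1E; apply/eqP => -[/eqP]; rewrite oner_eq0.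
have e01 (t : R) : ((0, 1) : R * R) + t *: ((1, 0) : R * R) != 0.
  rewrite -[X in X + _]scale1r addrC e1E.
  by apply/eqP => -[_ /eqP]; rewrite oner_eq0.
have n1 : ((1, 0) : R * R) != 0 by apply/eqP => -[/eqP]; rewrite oner_eq0.
have n2 : ((0, 1) : R * R) != 0 by apply/eqP => -[/eqP]; rewrite oner_eq0.
have [M1 M10 h1] := is_norm_coord_le n2 e10.
have [M2 M20 h2] := is_norm_coord_le n1 e01.
exists (M1 + M2) => [|[x y]]; first lra.
have := h1 x y; have := h2 y x; rewrite [X in N X]addrC e1E => hy hx.
have NX := is_norm_ge0 (x, y).
rewrite prod_normE /= ge_max; apply/andP; split; nra.
Qed.

End NormOnThePlane.

Lemma cvg_halving (R : realType) (V : normedModType R) (u : nat -> V) (l : V) :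
  (forall n, `|u n.+1 - l| <= 2^-1 * `|u n - l|) -> u @ \oo --> l.
Proof.
move=> hu.
have dec n : `|u n - l| <= geometric `|u 0%N - l| 2^-1 n.
  elim: n => [|n IHn]; rewrite /geometric /= ?expr0 ?mulr1//.
  rewrite exprS mulrCA; apply: (le_trans (hu n)).
  by rewrite ler_wpM2l// invr_ge0.
have geo0 : geometric `|u 0%N - l| 2^-1 n @[n --> \oo] --> (0 : R).
  by apply: cvg_geometric; rewrite ger0_norm ?invf_lt1 ?invr_ge0// ltr1n.
suff nu0 : `|u n - l| @[n --> \oo] --> (0 : R).
  by apply/subr_cvg0; exact: norm_cvg0 nu0.
apply: (squeeze_cvgr _ (cvg_cst 0) geo0).
by near=> n; rewrite normr_ge0 dec.
Unshelve. all: by end_near. Qed.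

(** The equilibrium equation removes the constant terms, so that the deviation
    of the new point carries the small factors [1 - al] and [1 - be]; their
    upper bounds are half the inverses of Lipschitz constants at the fixed
    point, [1 + a (K + 2 |xs|)] and [1 + b] (the second one enlarged from [b] to
    be at least 1), of the two coordinates of the Henon map on the square of
    radius [K]. *)
Lemma henon_pbc_halves (R : realType) (a b xs ys K al be x y : R) :
  0 < a -> 0 < b -> henon_equilibrium a b (xs, ys) ->
  0 <= 1 - al <= (2 * (1 + a * (K + 2 * `|xs|)))^-1 ->
  0 <= 1 - be <= (2 * (1 + b))^-1 ->
  `|(x, y) - (xs, ys)| <= K ->
  `|(al * xs + (1 - al) * (y + 1 - a * x ^+ 2),
     be * ys + (1 - be) * (b * x)) - (xs, ys)|
    <= 2^-1 * `|(x, y) - (xs, ys)|.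
Proof.
move=> a0 b0 [ex ey] /andP[al0 al1] /andP[be0 be1].
rewrite !prod_normE /=; set h := Num.max `|x - xs| _ => hK.
have xh : `|x - xs| <= h by rewrite le_max lexx.
have yh : `|y - ys| <= h by rewrite le_max lexx orbT.
have h0 : 0 <= h := le_trans (normr_ge0 _) xh.
have xs0 := normr_ge0 xs.
rewrite ge_max; apply/andP; split.
- have -> : al * xs + (1 - al) * (y + 1 - a * x ^+ 2) - xs
          = (1 - al) * ((y - ys) - a * ((x - xs) * ((x - xs) + 2 * xs))).
    by rewrite -[in LHS]ex; ring: ex.
  rewrite normrM (ger0_norm al0).
  set c := 1 + a * (K + 2 * `|xs|) in al1.
  have c0 : 0 < c by rewrite /c; nra.
  have hc : `|(y - ys) - a * ((x - xs) * ((x - xs) + 2 * xs))| <= c * h.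
    apply: (le_trans (ler_normB _ _)); rewrite !normrM (gtr0_norm a0).
    have t : `|x - xs + 2 * xs| <= K + 2 * `|xs|.
      apply: (le_trans (ler_normD _ _)); rewrite normrM ger0_norm//; lra.
    have : `|x - xs| * `|x - xs + 2 * xs| <= h * (K + 2 * `|xs|).
      exact: ler_pM.
    by rewrite /c; nra.
  apply: (le_trans (ler_pM al0 (normr_ge0 _) al1 hc)).
  by rewrite invfM mulrA -(mulrA 2^-1) mulVf ?mulr1 ?gt_eqF.
- have -> : be * ys + (1 - be) * (b * x) - ys = (1 - be) * (b * (x - xs)).
    by rewrite -ey /=; ring.
  rewrite !normrM (ger0_norm be0) (gtr0_norm b0).
  have c0 : 0 < 1 + b by lra.
  have hc : b * `|x - xs| <= (1 + b) * h by nra.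
  have bx0 : 0 <= b * `|x - xs| by rewrite mulr_ge0// ltW.
  apply: (le_trans (ler_pM be0 bx0 be1 hc)).
  by rewrite invfM mulrA -(mulrA 2^-1) mulVf ?mulr1 ?gt_eqF.
Qed.

(* Convergence in [R * R] is for its product topology, which is the topology
   of every norm on the plane. *)
Theorem proposition2p4 (R : realType) (N : R * R -> R) (hN : is_norm N)
    (a b : R) (ha : 0 < a) (hb : 0 < b)
    (xs ys : R) (heq : henon_equilibrium a b (xs, ys))
    (r : R) (hr0 : 0 < r) (hr : r < `|xs|) :
  exists alpha_s beta_s : R,
    [/\ 0 <= alpha_s < 1,
        0 <= beta_s < 1 &
        forall (alpha beta : nat -> R),
          (forall n, alpha_s < alpha n < 1) ->
          (forall n, beta_s < beta n < 1) ->
          forall x y : nat -> R,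
            norm_ball N (xs, ys) r (x 0%N, y 0%N) ->
            (forall n, x n.+1 =
               alpha n * xs + (1 - alpha n) * (y n + 1 - a * x n ^+ 2)) ->
            (forall n, y n.+1 =
               beta n * ys + (1 - beta n) * (b * x n)) ->
            (x n, y n) @[n --> \oo] --> (xs, ys)].
Proof.
have [M M0 NM] := is_norm_dominates hN.
have K0 : 0 < M * r by rewrite mulr_gt0.
set K := M * r in K0.
have c1 : 1 <= 1 + a * (K + 2 * `|xs|) by have := normr_ge0 xs; nra.
set c := 1 + a * (K + 2 * `|xs|) in c1.
have bnd (d : R) : 1 <= d -> 0 <= 1 - (2 * d)^-1 < 1.
  move=> d1; rewrite subr_ge0 invf_le1; last lra.
  by rewrite ltrBlDr ltrDl invr_gt0; apply/andP; split; lra.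
exists (1 - (2 * c)^-1), (1 - (2 * (1 + b))^-1); split; try by apply: bnd; lra.
move=> alpha beta alphaP betaP x y xy0 xS yS.
have ctl (d t : R) : 1 - d < t < 1 -> 0 <= 1 - t <= d.
  by move=> /andP[? ?]; apply/andP; split; lra.
have halves n : `|(x n, y n) - (xs, ys)| <= K ->
    `|(x n.+1, y n.+1) - (xs, ys)| <= 2^-1 * `|(x n, y n) - (xs, ys)|.
  by rewrite xS yS; apply: (henon_pbc_halves ha hb heq); exact: ctl.
have bounded n : `|(x n, y n) - (xs, ys)| <= K.
  elim: n => [|n IHn].
    by apply: (le_trans (NM _)); rewrite ler_wpM2l// ltW.
  have := halves n IHn; have := normr_ge0 ((x n, y n) - (xs, ys)); lra.
by apply: (@cvg_halving _ _ (fun n => (x n, y n))) => n; exact: halves.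
Qed.
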